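(* For all real $\alpha,\beta>0$ there exists an integer $K=K(\alpha,\beta)\geq1$, depending only on $\alpha$ and $\beta$, such that for all $E_1,E_2\subseteq\mathbb{Z}$ with $d^\star(E_1)=\alpha$ and $d^\star(E_2)=\beta$, $$K\mathbb{Z}\subseteq(E_1-E_1)^2-(E_2-E_2)^2.$$
   Context: For $A,B\subseteq\mathbb{Z}$, $A-B=\{a-b:a\in A,\ b\in B\}$, and $A^2:=\{a^2:a\in A\}$ is the set of pointwise squares (not the product set). Thus $(E_1-E_1)^2-(E_2-E_2)^2=\{x^2-y^2:x\in E_1-E_1,\ y\in E_2-E_2\}$. The upper Banach density of $A\subseteq\mathbb{Z}$ is $d^\star(A)=\lim_{N\to\infty}\sup_{z\in\mathbb{Z}}\frac{|A\cap(z+[-N,N])|}{2N+1}$, where $[-N,N]$ denotes an integer interval. *)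

(* Defs.v *)
From HB Require Import structures.
From mathcomp Require Import all_boot all_order all_algebra finmap zify.
From mathcomp Require Import all_classical all_reals all_analysis.

Set Implicit Arguments.
Unset Strict Implicit.
Unset Printing Implicit Defensive.

Import Order.TTheory GRing.Theory Num.Theory.
Import numFieldNormedType.Exports.

Local Open Scope classical_set_scope.
Local Open Scope ring_scope.

Definition diffset (A B : set int) : set int :=
  [set a - b | a in A & b in B].

(* Pointwise squares, not the product set. *)
Definition sqset (A : set int) : set int := [set a ^+ 2 | a in A].

Definition multiples (K : int) : set int := [set K * m | m in [set: int]].

Definition window (z : int) (N : nat) : set int :=
  [set x | z - N%:Z <= x <= z + N%:Z].

Lemma finite_window (z : int) (N : nat) : finite_set (window z N).
Proof.
apply: (@sub_finite_set _ _ ((fun k : nat => z - N%:Z + k%:Z) @` `I_(N.*2.+1))).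
  move=> x /andP[lx xu]; have d0 : 0 <= x - (z - N%:Z) by rewrite subr_ge0.
  exists `|(x - (z - N%:Z))%R|%N; last by rewrite gez0_abs// addrC subrK.
  by rewrite /= ltnS -lez_nat gez0_abs//; lia.
exact/finite_image/finite_II.
Qed.

(* The cardinality is a genuine count, as windows are finite. *)
Definition window_count (A : set int) (z : int) (N : nat) : nat :=
  #|` fset_set (A `&` window z N)|.

(* The sup ranges over a nonempty subset of [0, 1], so it is the true supremum
   and not the default value of [sup]. *)
Definition max_window_density (R : realType) (A : set int) (N : nat) : R :=
  sup (range (fun z : int => (window_count A z N)%:R / (N.*2.+1)%:R)).

(* The limit always exists: the maximal count over windows of length L is
   subadditive in L. Hence [limn] never takes its default value here. *)
Definition upper_banach_density (R : realType) (A : set int) : R :=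
  limn (max_window_density R A).

(* Main.v *)
Require Import Defs.
From HB Require Import structures.
From mathcomp Require Import all_boot all_order all_algebra finmap ring lra zify.
From mathcomp Require Import all_classical all_reals all_analysis.

Set Implicit Arguments.
Unset Strict Implicit.
Unset Printing Implicit Defensive.

Import Order.TTheory GRing.Theory Num.Theory.
Import numFieldNormedType.Exports.

Local Open Scope classical_set_scope.
Local Open Scope ring_scope.

(** Since [(s + t)^2 - (s - t)^2 = 4 s t], it is enough to find [N], depending
    only on the two densities, such that for every integer [m] some
    factorization [N = a b] has [b m + a] in [E1 - E1] and [b m - a] in [E2 - E2];
    then [K = 4 N] works.

    Cut [E1] and [E2] down to dense windows, and place these in [Z/qZ] with [q]
    just large enough to prevent wrap-around.  For frequencies [(c, d)], let [p (c, d)]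
    be the squared modulus of the Fourier coefficient at [c] of the first window
    times that at [d] of the second; let [v] be the difference of the two
    angles and [w] be [m] times their sum.  If a factorization [N = a b] fails,
    then the sum of [p cos (a v + b w)] over all frequencies is zero.
    Density says that the mass of [p] at the origin is a fixed proportion of its
    total mass.  So all factorizations cannot fail if the functions [cos (a v + b w)]
    with [a b = N] have a nonnegative combination [F] which is nowhere below
    a small multiple of [- F (0, 0)]: this is [hyperbola_recurrence].  As the bound on
    [F] holds for all real [v] and [w], the integer [m] has no influence on [N].

    The building block of [F] is [scale_sum]: for [k < m'] and [i < j < n] it uses a
    factor [a] of the form [(j - i) g / (k + 1)] and a factor [b] of the
    form [(k + 1) (n! / (j - i)) D], where [D] is a dilation which fixes the scale.  Put
    [psi = D w].
    - If [psi] is within much less than [1 / m'] of a period, the terms [b w] are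
      negligible modulo periods, and the sum over [i < j] is half of the square of the
      modulus of an exponential sum, minus [n / 2]
      ([scale_sum_ge_resonant]).
    - If no small multiple of [psi] is within about [1 / m'] of a period, the
      sum cancels, whatever the phases [a v] are: Cauchy-Schwarz eliminates them
      ([bilinear_phase_bound]), and leaves correlations whose average over [k] is
      small except on a diagonal ([scale_sum_ge_generic]).

    In the remaining cases nothing is known at that scale.  But the dilations [D] run
    through the powers of a large factorial while the lengths [m'] decrease
    faster than the dilations increase, so that a [psi] which is close to a rational
    multiple of a period at one scale is resonant at all later ones
    ([resonant_after_nongeneric]).  Hence at most one scale is bad for each [w], and
    an average over [r] scales loses only a proportion [1 / r]
    ([multiscale_lower_bound]). *)

(** * Trigonometric sums *)

Section Trigonometry.
Variable R : realType.
Implicit Types x y : R.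

Lemma normr_cos_le1 x : `|cos x| <= 1.
Proof. by rewrite ler_norml cos_geN1 cos_le1. Qed.

Lemma normr_sin_natmul n x : `|sin (n%:R * x)| <= n%:R * `|sin x|.
Proof.
elim: n => [|n IHn]; first by rewrite !mul0r sin0 normr0.
rewrite -natr1 mulrDl mul1r sinD (le_trans (ler_normD _ _))// !normrM mulrDl mul1r.
by rewrite lerD// ?ler_piMl ?normr_cos_le1// (le_trans _ IHn)// ler_piMr ?normr_cos_le1.
Qed.

(** Multiplying by the sine of half the step makes the sum telescope. *)
Lemma sum_cos_telescope m x y :
  2 * sin (x / 2) * (\sum_(k < m) cos (k%:R * x + y)) =
  sin (m%:R * x + (y - x / 2)) - sin (y - x / 2).
Proof.
elim: m => [|m IHm]; first by rewrite big_ord0 mul0r add0r mulr0 subrr.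
rewrite big_ord_recr /= mulrDr IHm.
have -> : m.+1%:R * x + (y - x / 2) = m%:R * x + y + x / 2.
  by rewrite -[m.+1%:R]natr1; field.
by rewrite [m%:R * x + (y - x / 2)]addrA (sinB (_ + y)) (sinD (_ + y)); ring.
Qed.

Lemma normr_sum_cos_le m x :
  `|sin (x / 2)| * `|\sum_(k < m) cos (k.+1%:R * x)| <= 1.
Proof.
under eq_bigr do rewrite -natr1 mulrDl mul1r.
rewrite -normrM -(ler_pM2l (ltr0Sn R 1)) mulr1.
rewrite -[X in X * _ <= _](ger0_norm (ler0n R 2)) -normrM mulrA sum_cos_telescope.
by rewrite (le_trans (ler_normB _ _))// [2%:R]mulr2n lerD ?sin_max.
Qed.

(** The telescoped sum closes up, because [q] steps make a whole number of periods,
    while the step is not a multiple of a period. *)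
Lemma sum_cos_period (q : nat) (z : int) y : z != 0 -> (`|z| < q)%N ->
  \sum_(c < q) cos (c%:R * (2 * pi * z%:~R / q%:R) + y) = 0.
Proof.
wlog z0 : z y / 0 < z => [hw zn0 zq|_ zq].
  have [zlt0|zgt0|z0] := ltgtP z 0; [|exact: hw|by rewrite z0 eqxx in zn0].
  rewrite -[RHS](hw (- z) (- y)) ?oppr_gt0 ?oppr_eq0 ?abszN//.
  by apply: eq_bigr => c _; rewrite -[RHS]cosN; congr cos; rewrite rmorphN; ring.
case: z z0 zq => // z z0 zq; have q0 : 0 < q%:R :> R by rewrite ltr0n (leq_ltn_trans _ zq).
set x := 2 * pi * _ / _.
have sinx0 : sin (x / 2) != 0.
  have -> : x / 2 = pi * (z%:R / q%:R) by rewrite /x -pmulrn; field; rewrite gt_eqF.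
  have frac0 : 0 < z%:R / q%:R :> R by rewrite divr_gt0// ltr0n.
  rewrite gt_eqF// sin_gt0_pi// mulr_gt0 ?pi_gt0//=.
  by rewrite gtr_pMr ?pi_gt0// ltr_pdivrMr// mul1r ltr_nat.
have sin20 : 2 * sin (x / 2) != 0 by rewrite mulf_eq0 negb_or sinx0 pnatr_eq0.
apply: (mulfI sin20).
apply/eqP; rewrite mulr0 sum_cos_telescope subr_eq0.
have -> : q%:R * x = (pi *+ 2) *+ z.
  by rewrite /x -pmulrn -mulrnA -[RHS]mulr_natl natrM; field; rewrite gt_eqF.
by rewrite addrC (periodicn (@sinD2pi R)).
Qed.

Lemma cos_perturb x y : cos x - 2 * `|sin (y / 2)| <= cos (x + y).
Proof.
have -> : cos (x + y) = cos x - 2 * (sin (x + y / 2) * sin (y / 2)).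
  have -> : x + y = (x + y / 2) + y / 2 by field.
  have {2}-> : x = (x + y / 2) - y / 2 by field.
  by rewrite cosD cosB; ring.
rewrite lerD2l lerN2 ler_pM2l// (le_trans (ler_norm _))// normrM.
by rewrite ler_piMl ?sin_max.
Qed.

(** The square of the modulus of an exponential sum, in real form. *)
Lemma sqr_trig_sum (I : finType) (w x : I -> R) :
  (\sum_i w i * cos (x i)) ^+ 2 + (\sum_i w i * sin (x i)) ^+ 2 =
  \sum_i \sum_j w i * w j * cos (x i - x j).
Proof.
rewrite !expr2 !big_distrl /= -big_split /=; apply: eq_bigr => i _.
rewrite !big_distrr /= -big_split /=; apply: eq_bigr => j _.
by rewrite cosB; ring.
Qed.

(** Adding [n] to the right-hand side gives the square of the modulus of
    the sum of [e(j x)] over [j < n]. *)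
Lemma fejer_lower_bound n x :
  - n%:R <= 2 * \sum_(j < n) \sum_(i < j) cos ((j - i)%N%:R * x).
Proof.
suff -> : 2 * (\sum_(j < n) \sum_(i < j) cos ((j - i)%N%:R * x)) =
    (\sum_(j < n) cos (j%:R * x)) ^+ 2 + (\sum_(j < n) sin (j%:R * x)) ^+ 2 - n%:R.
  by rewrite lerDr addr_ge0 ?sqr_ge0.
elim: n => [|n IHn]; first by rewrite !big_ord0; ring.
rewrite !big_ord_recr /= mulrDr IHn.
have -> : \sum_(i < n) cos ((n - i)%N%:R * x) =
    cos (n%:R * x) * (\sum_(i < n) cos (i%:R * x)) +
    sin (n%:R * x) * (\sum_(i < n) sin (i%:R * x)).
  rewrite !big_distrr -big_split; apply: eq_bigr => i _ /=.
  by rewrite natrB ?mulrBl ?cosB// ltnW.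
have := cos2Dsin2 (n%:R * x); rewrite -[n.+1%:R]natr1.
move: (cos _) (sin _) => c s cs1.
have -> : n%:R + 1 = n%:R + (c ^+ 2 + s ^+ 2) by rewrite cs1.
ring.
Qed.

Lemma amgm_lower (t eta : R) : 0 < eta -> - (eta + t ^+ 2 / (4 * eta)) <= t.
Proof.
move=> eta0; rewrite -subr_ge0.
have -> : t - - (eta + t ^+ 2 / (4 * eta)) = (t + 2 * eta) ^+ 2 / (4 * eta).
  by field; rewrite gt_eqF.
by rewrite divr_ge0 ?sqr_ge0// mulr_ge0// ltW.
Qed.

Lemma amgm_upper (c s a b kappa : R) : 0 < kappa -> c ^+ 2 + s ^+ 2 = 1 ->
  c * a - s * b <= (kappa + (a ^+ 2 + b ^+ 2) / kappa) / 2.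
Proof.
move=> k0 cs1; rewrite -subr_ge0.
have -> : (kappa + (a ^+ 2 + b ^+ 2) / kappa) / 2 - (c * a - s * b) =
    ((kappa * c - a) ^+ 2 + (kappa * s + b) ^+ 2) / (2 * kappa).
  have {1}-> : kappa = kappa * (c ^+ 2 + s ^+ 2) by rewrite cs1 mulr1.
  by field; rewrite gt_eqF.
by rewrite divr_ge0 ?addr_ge0 ?sqr_ge0// mulr_ge0// ltW.
Qed.

(** The bound does not involve the one-variable phases [y] and [z].  For
    each [j], bounding a real part by a modulus removes [y j]; squaring out and
    exchanging the sums leaves, for each pair [(i, i')], a phase [z i - z i'] times a
    sum over [j], and the same step removes it.  Using the
    arithmetic-geometric mean inequality in place of square roots keeps the
    bound linear in the final correlations, so that it can be averaged. *)
Lemma bilinear_phase_bound n (w a : 'I_n -> 'I_n -> R) (y z : 'I_n -> R)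
    (eta kappa : R) : 0 < eta -> 0 < kappa ->
  - (n%:R * eta + (8 * eta)^-1 * (n%:R ^+ 2 * kappa + kappa^-1 *
      \sum_i \sum_i' \sum_j \sum_j' (w i j * w i' j) * (w i j' * w i' j') *
        cos ((a i j - a i' j) - (a i j' - a i' j')))) <=
  \sum_j \sum_i w i j * cos (y j + (z i + a i j)).
Proof.
move=> eta0 kappa0.
pose A j := \sum_i w i j * cos (z i + a i j).
pose B j := \sum_i w i j * sin (z i + a i j).
pose C i i' := \sum_j w i j * w i' j * cos (a i j - a i' j).
pose D i i' := \sum_j w i j * w i' j * sin (a i j - a i' j).
have -> : \sum_j \sum_i w i j * cos (y j + (z i + a i j)) =
    \sum_j (cos (y j) * A j - sin (y j) * B j).
  apply: eq_bigr => j _; rewrite /A /B !big_distrr -sumrB /=.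
  by apply: eq_bigr => i _; rewrite cosD; ring.
have stepj j : - (eta + (4 * eta)^-1 * (A j ^+ 2 + B j ^+ 2)) <=
    cos (y j) * A j - sin (y j) * B j.
  apply: le_trans (amgm_lower _ eta0); rewrite lerN2 lerD2l mulrC.
  rewrite ler_pM2l ?invr_gt0 ?mulr_gt0// -subr_ge0.
  have -> : A j ^+ 2 + B j ^+ 2 = (cos (y j) ^+ 2 + sin (y j) ^+ 2) * (A j ^+ 2 + B j ^+ 2).
    by rewrite cos2Dsin2 mul1r.
  rewrite [X in 0 <= X](_ : _ = (sin (y j) * A j + cos (y j) * B j) ^+ 2) ?sqr_ge0//; ring.
apply: (le_trans _ (ler_sum _ (fun j _ => stepj j))).
rewrite sumrN lerN2 big_split /= sumr_const card_ord -[eta *+ _]mulr_natl lerD2l -mulr_sumr.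
have -> : \sum_j (A j ^+ 2 + B j ^+ 2) =
    \sum_i \sum_i' (cos (z i - z i') * C i i' - sin (z i - z i') * D i i').
  under eq_bigr do rewrite sqr_trig_sum.
  rewrite exchange_big /=; apply: eq_bigr => i _.
  rewrite exchange_big /=; apply: eq_bigr => i' _.
  rewrite /C /D !big_distrr -sumrB /=; apply: eq_bigr => j _.
  have -> : z i + a i j - (z i' + a i' j) = (z i - z i') + (a i j - a i' j) by ring.
  by rewrite cosD; ring.
have stepi i i' : cos (z i - z i') * C i i' - sin (z i - z i') * D i i' <=
    (kappa + (C i i' ^+ 2 + D i i' ^+ 2) / kappa) / 2.
  exact/amgm_upper/cos2Dsin2.
have -> : (8 * eta)^-1 = (4 * eta)^-1 * 2^-1 :> R by field; rewrite gt_eqF.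
rewrite -mulrA ler_pM2l ?invr_gt0 ?mulr_gt0//.
apply: (@le_trans _ _ (\sum_(i < n) \sum_(i' < n)
    (kappa + (C i i' ^+ 2 + D i i' ^+ 2) / kappa) / 2)).
  by apply: ler_sum => i _; apply: ler_sum => i' _; exact: stepi.
have -> : n%:R ^+ 2 * kappa = \sum_(i < n) \sum_(i' < n) kappa.
  by rewrite !sumr_const !card_ord -mulrnA -[RHS]mulr_natl natrM expr2.
rewrite mulr_sumr -big_split /= mulr_sumr ler_sum// => i _.
rewrite mulr_sumr -big_split /= mulr_sumr ler_sum// => i' _.
by rewrite [X in X <= _]mulrC sqr_trig_sum [_ / kappa]mulrC.
Qed.

End Trigonometry.

(** * A single scale *)

(** Clearing denominators in the mixed difference of [1 / (j - i)] leaves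
    [(i - i') (j' - j) ((j - i) + (j' - i'))], and the last factor is positive. *)
Lemma second_difference_neq0 (p i i' j j' : nat) : (0 < p)%N ->
  (forall d, (0 < d <= maxn j j')%N -> (d %| p)%N) ->
  (i < j)%N -> (i' < j)%N -> (i < j')%N -> (i' < j')%N -> i != i' -> j != j' ->
  (p %/ (j - i))%N%:Z - (p %/ (j - i'))%N%:Z -
    ((p %/ (j' - i))%N%:Z - (p %/ (j' - i'))%N%:Z) != 0 :> int.
Proof.
move=> p0 pdiv ij i'j ij' i'j' ii' jj'.
have quo k l : (k < l)%N -> (l <= maxn j j')%N ->
    (p %/ (l - k))%N%:Z * (l%:Z - k%:Z) = p%:Z.
  move=> kl lm; rewrite subzn 1?ltnW// -PoszM divnK// pdiv// subn_gt0 kl.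
  by rewrite (leq_trans (leq_subr _ _)).
have := quo _ _ ij (leq_maxl _ _); have := quo _ _ i'j (leq_maxl _ _).
have := quo _ _ ij' (leq_maxr _ _); have := quo _ _ i'j' (leq_maxr _ _).
move: (p %/ _)%N (p %/ _)%N (p %/ _)%N (p %/ _)%N => u1 u2 u3 u4 e4 e3 e2 e1.
apply/eqP => d0.
have : p%:Z * ((i%:Z - i'%:Z) * (j'%:Z - j%:Z) * ((j%:Z - i%:Z) + (j'%:Z - i'%:Z))) = 0.
  transitivity ((u1%:Z - u2%:Z - (u3%:Z - u4%:Z)) * ((j%:Z - i%:Z) *
     (j%:Z - i'%:Z) * (j'%:Z - i%:Z) * (j'%:Z - i'%:Z))); last by rewrite d0 mul0r.
  transitivity ((u1%:Z * (j%:Z - i%:Z)) * (j%:Z - i'%:Z) * (j'%:Z - i%:Z) * (j'%:Z - i'%:Z)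
    - (u2%:Z * (j%:Z - i'%:Z)) * (j%:Z - i%:Z) * (j'%:Z - i%:Z) * (j'%:Z - i'%:Z)
    - (u3%:Z * (j'%:Z - i%:Z)) * (j%:Z - i%:Z) * (j%:Z - i'%:Z) * (j'%:Z - i'%:Z)
    + (u4%:Z * (j'%:Z - i'%:Z)) * (j%:Z - i%:Z) * (j%:Z - i'%:Z) * (j'%:Z - i%:Z)).
    by rewrite e1 e2 e3 e4; ring.
  ring.
move/eqP; rewrite !mulf_eq0; lia.
Qed.

Lemma absz_second_difference_le (u1 u2 u3 u4 p : nat) :
  (u1 <= p)%N -> (u2 <= p)%N -> (u3 <= p)%N -> (u4 <= p)%N ->
  (`|(u1%:Z - u2%:Z - (u3%:Z - u4%:Z))%R| <= 4 * p)%N.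
Proof. lia. Qed.

Section SingleScale.
Variable R : realType.
Implicit Types (x : nat -> R) (psi : R).

(** With [x k] a multiple of [v] by a number proportional to the inverse of
    [k + 1] and [psi] a multiple of [w], the summand is the cosine of [a v + b w]
    where the product [a b] is the same for all terms. *)
Definition scale_sum n m x psi : R :=
  \sum_(k < m) \sum_(j < n) \sum_(i < j)
    cos ((j - i)%N%:R * x k + (k.+1 * (n`! %/ (j - i)))%N%:R * psi).

Lemma scale_sum_ge_trivial n m x psi : - (m%:R * n%:R ^+ 2) <= scale_sum n m x psi.
Proof.
rewrite lerNl -sumrN.
rewrite [leRHS](_ : _ = \sum_(k < m) n%:R ^+ 2); last first.
  by rewrite sumr_const card_ord mulr_natl.
apply: ler_sum => k _; rewrite -sumrN.
rewrite [leRHS](_ : _ = \sum_(j < n) n%:R); last first.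
  by rewrite sumr_const card_ord -[RHS]mulr_natl expr2.
apply: ler_sum => j _; rewrite -sumrN.
apply: (@le_trans _ _ (\sum_(i < j) 1)).
  by apply: ler_sum => i _; rewrite lerNl cos_geN1.
by rewrite sumr_const card_ord ler_nat ltnW.
Qed.

(** If [psi] is very close to a period, the [psi]-part of each phase can
    be dropped, and what remains is nonnegative up to its diagonal. *)
Lemma scale_sum_ge_resonant n m x psi : (0 < n)%N ->
  m%:R * n`!%:R * `|sin (psi / 2)| * n%:R <= 1 ->
  - (3 * m%:R * n%:R) <= scale_sum n m x psi.
Proof.
move=> n0 small.
rewrite [leLHS](_ : _ = \sum_(k < m) - (3 * n%:R)); last first.
  by rewrite sumr_const card_ord -[RHS]mulr_natl; ring.
apply: ler_sum => k _; have nR0 : 0 < n%:R :> R by rewrite ltr0n.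
have term (j : 'I_n) (i : 'I_j) : cos ((j - i)%N%:R * x k) - 2 * n%:R^-1 <=
    cos ((j - i)%N%:R * x k + (k.+1 * (n`! %/ (j - i)))%N%:R * psi).
  apply: le_trans (cos_perturb _ _); rewrite lerD2l lerN2 ler_pM2l//.
  rewrite -mulrA (le_trans (normr_sin_natmul _ _))//.
  rewrite -[n%:R^-1]mul1r ler_pdivlMr// (le_trans _ small)// ler_pM2r//.
  by rewrite ler_wpM2r// -natrM ler_nat leq_mul// leq_div.
apply: (@le_trans _ _ (\sum_(j < n) \sum_(i < j) (cos ((j - i)%N%:R * x k) - 2 * n%:R^-1))).
  rewrite (eq_bigr (fun j : 'I_n => \sum_(i < j) cos ((j - i)%N%:R * x k) -
      j%:R * (2 * n%:R^-1))); last first.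
    by move=> j _; rewrite big_split /= sumr_const card_ord -[_ *+ j]mulr_natl mulrN.
  rewrite big_split sumrN /=.
  have := fejer_lower_bound n (x k).
  have : \sum_(j < n) j%:R * (2 * n%:R^-1) <= 2 * n%:R :> R.
    apply: (@le_trans _ _ (\sum_(j < n) 2 : R)).
      apply: ler_sum => j _; rewrite mulrCA ler_piMr//.
      by rewrite ler_pdivrMr// mul1r ler_nat ltnW.
    by rewrite sumr_const card_ord -[_ *+ n]mulr_natl mulrC.
  move: (\sum_(j < n) _) (\sum_(j < n) _) nR0 => s1 s2; lra.
by apply: ler_sum => j _; apply: ler_sum => i _; exact: term.
Qed.

Lemma scale_sum_termE n m x psi : scale_sum n m x psi =
  \sum_(k < m) \sum_(j < n) \sum_(i < n) (i < j)%N%:R *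
    cos (j%:R * x k + (- (i%:R * x k) + (k.+1 * (n`! %/ (j - i)))%N%:R * psi)).
Proof.
apply: eq_bigr => k _; apply: eq_bigr => j _.
rewrite (big_ord_widen n (fun i => cos ((j - i)%N%:R * x k +
   (k.+1 * (n`! %/ (j - i)))%N%:R * psi)) (ltnW (ltn_ord j))) big_mkcond /=.
apply: eq_bigr => i _; case: ifPn => ij; last by rewrite mul0r.
by rewrite mul1r natrB ?(ltnW ij)// mulrBl addrA.
Qed.

(** Unless [i = i'] or [j = j'], the phase is [k + 1] times a nonzero
    multiple of [psi], so that the sum over [k] is small. *)
Lemma correlation_le n m psi (i i' j j' : 'I_n) : (0 < n)%N ->
  (forall h, (0 < h <= 4 * n`!)%N -> n%:R <= m%:R * `|sin (h%:R * (psi / 2))|) ->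
  forall (a : nat -> nat -> nat -> R) (w : nat -> nat -> R),
  (forall k i j, a k i j = (k.+1 * (n`! %/ (j - i)))%N%:R * psi) ->
  (forall i j, w i j = (i < j)%N%:R) ->
  \sum_(k < m) (w i j * w i' j) * (w i j' * w i' j') *
      cos ((a k i j - a k i' j) - (a k i j' - a k i' j')) <=
    m%:R * ((i == i')%:R + (j == j')%:R + n%:R^-1).
Proof.
move=> n0 large a w aE wE.
have nR0 : 0 < n%:R :> R by rewrite ltr0n.
have [/andP[/andP[ij i'j] /andP[ij' i'j']]|] :=
    boolP (((i < j) && (i' < j)) && ((i < j') && (i' < j')))%N; last first.
  rewrite !wE -!natrM !mulnb => /negbTE ->.
  by rewrite big1 => [|k _]; rewrite ?mul0r// mulr_ge0// !addr_ge0// invr_ge0.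
rewrite !wE ij i'j ij' i'j' !mulr1.
have [/orP e|] := boolP ((i == i') || (j == j')).
  apply: (@le_trans _ _ m%:R).
    rewrite -[leRHS](_ : \sum_(k < m) 1 = _); last by rewrite sumr_const card_ord.
    by apply: ler_sum => k _; rewrite mul1r cos_le1.
  rewrite ler_peMr//; have : 0 <= n%:R^-1 :> R by rewrite invr_ge0.
  by case: e => ->; case: (_ == _) => /=; lra.
rewrite negb_or => /andP[ii' jj']; rewrite (negbTE ii') (negbTE jj') !add0r.
pose d : int := (n`! %/ (j - i))%N%:Z - (n`! %/ (j - i'))%N%:Z -
    ((n`! %/ (j' - i))%N%:Z - (n`! %/ (j' - i'))%N%:Z).
have d0 : d != 0.
  apply: second_difference_neq0 => //; first exact: fact_gt0.
  move=> h /andP[h0 hn]; apply: dvdn_fact; rewrite h0 (leq_trans hn)//.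
  by rewrite geq_max (ltnW (ltn_ord j)) (ltnW (ltn_ord j')).
have dle : (`|d| <= 4 * n`!)%N.
  by apply: absz_second_difference_le; exact: leq_div.
have phase k : cos ((a k i j - a k i' j) - (a k i j' - a k i' j')) =
    cos (k.+1%:R * (`|d|%N%:R * psi)).
  have -> : (a k i j - a k i' j) - (a k i j' - a k i' j') = k.+1%:R * (d%:~R * psi).
    by rewrite !aE /d !natrM !rmorphB /=; ring.
  have [dge0|dlt0] := leP 0 d; first by rewrite -[in LHS](gez0_abs dge0).
  by rewrite -[d in LHS]opprK -(ltz0_abs dlt0) rmorphN mulNr mulrN cosN.
under eq_bigr do rewrite mul1r phase.
have {}large : n%:R <= m%:R * `|sin (`|d|%N%:R * (psi / 2))|.
  by apply: large; rewrite absz_gt0 d0.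
have := normr_sum_cos_le m (`|d|%N%:R * psi); rewrite -mulrA.
have sum_le := ler_norm (\sum_(k < m) cos (k.+1%:R * (`|d|%N%:R * psi))).
move: `|\sum_(k < m) _| (normr_ge0 (\sum_(k < m) cos (k.+1%:R * (`|d|%N%:R * psi)))) sum_le.
move=> s s0 sum_le sin_le; apply: (le_trans sum_le).
rewrite ler_pdivlMr// (le_trans (y := s * (m%:R * `|sin (`|d|%N%:R * (psi / 2))|)))//.
  by rewrite ler_wpM2l.
by rewrite mulrCA ler_piMr// mulrC.
Qed.

(** If no small multiple of [psi] is near a period, the bilinear
    inequality reduces the sum to correlations, few of which are large. *)
Lemma scale_sum_ge_generic n m x psi (eta kappa : R) : (0 < n)%N ->
  0 < eta -> 0 < kappa ->
  (forall h, (0 < h <= 4 * n`!)%N -> n%:R <= m%:R * `|sin (h%:R * (psi / 2))|) ->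
  - (m%:R * (n%:R * eta + (8 * eta)^-1 *
      (n%:R ^+ 2 * kappa + kappa^-1 * (3 * n%:R ^+ 3)))) <= scale_sum n m x psi.
Proof.
move=> n0 eta0 kappa0 large; rewrite scale_sum_termE.
pose a k (i j : nat) := (k.+1 * (n`! %/ (j - i)))%N%:R * psi.
pose w (i j : nat) : R := (i < j)%N%:R.
pose corr k (i i' j j' : 'I_n) := (w i j * w i' j) * (w i j' * w i' j') *
      cos ((a k i j - a k i' j) - (a k i j' - a k i' j')).
have step (k : 'I_m) := bilinear_phase_bound (fun i j : 'I_n => w i j)
  (fun i j : 'I_n => a k i j) (fun j : 'I_n => j%:R * x k)
  (fun i : 'I_n => - (i%:R * x k)) eta0 kappa0.
apply: le_trans (ler_sum _ (fun k _ => step k)); rewrite sumrN lerN2.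
rewrite -/(corr _ _ _ _ _).
rewrite big_split /= sumr_const card_ord -[(n%:R * eta) *+ m]mulr_natl -mulr_sumr.
rewrite big_split /= sumr_const card_ord -[(n%:R ^+ 2 * kappa) *+ m]mulr_natl -mulr_sumr.
rewrite [leRHS]mulrDr lerD2l [leRHS]mulrCA ler_pM2l ?invr_gt0 ?mulr_gt0//.
rewrite [leRHS]mulrDr lerD2l [leRHS]mulrCA ler_pM2l ?invr_gt0//.
have -> : \sum_(k < m) \sum_i \sum_i' \sum_j \sum_j' corr k i i' j j' =
    \sum_i \sum_i' \sum_j \sum_j' \sum_(k < m) corr k i i' j j'.
  rewrite exchange_big; apply: eq_bigr => i _.
  rewrite exchange_big; apply: eq_bigr => i' _.
  rewrite exchange_big; apply: eq_bigr => j _.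
  by rewrite exchange_big.
apply: (@le_trans _ _ (\sum_i \sum_i' \sum_j \sum_j'
    m%:R * ((i == i' :> 'I_n)%:R + (j == j' :> 'I_n)%:R + n%:R^-1))).
  apply: ler_sum => i _; apply: ler_sum => i' _; apply: ler_sum => j _.
  by apply: ler_sum => j' _; exact: (@correlation_le n m psi i i' j j' n0 large a w).
have delta (i : 'I_n) : \sum_(i' < n) (i == i')%:R = 1 :> R.
  by rewrite (bigD1 i)//= eqxx big1 ?addr0// => i' ii'; rewrite eq_sym (negbTE ii').
have cst (c : R) : \sum_(i < n) c = n%:R * c.
  by rewrite sumr_const card_ord mulr_natl.
have nV : n%:R * n%:R^-1 = 1 :> R by rewrite divff// pnatr_eq0 -lt0n.
have inner (i i' : 'I_n) :
    \sum_(j < n) \sum_(j' < n) m%:R * ((i == i')%:R + (j == j')%:R + n%:R^-1) =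
    m%:R * n%:R * (n%:R * (i == i')%:R + 2) :> R.
  rewrite [RHS](_ : _ = n%:R * (m%:R * (n%:R * (i == i')%:R + 2))); last by ring.
  rewrite -cst; apply: eq_bigr => j _.
  by rewrite -mulr_sumr !big_split /= delta !cst nV -addrA.
rewrite (_ : \sum_i _ = \sum_(i < n) m%:R * (3 * n%:R ^+ 2)).
  by rewrite cst [leRHS]mulrCA le_eqVlt; apply/orP; left; apply/eqP; ring.
apply: eq_bigr => i _; rewrite (eq_bigr _ (fun i' _ => inner i i')).
by rewrite -mulr_sumr big_split /= -mulr_sumr delta cst; ring.
Qed.

End SingleScale.

(** * Averaging over scales *)

Section Scales.
Variable R : realType.

(** The choices [n = r ^ 4], [eta = r ^ 3] and [kappa = r ^ 2] balance the three
    error terms of the generic bound: each is of order [r ^ 7], to be compared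
    with the number of order [r ^ 8] of pairs [i < j]. *)
Lemma scale_sum_ge_generic_or_resonant r m (x : nat -> R) psi : (0 < r)%N ->
  let n := (r ^ 4)%N in
  m%:R * n`!%:R * `|sin (psi / 2)| * n%:R <= 1 \/
  (forall h, (0 < h <= 4 * n`!)%N -> n%:R <= m%:R * `|sin (h%:R * (psi / 2))|) ->
  - (3 * m%:R * r%:R ^+ 7) <= scale_sum n m x psi.
Proof.
move=> r0 n; have rR0 : 0 < r%:R :> R by rewrite ltr0n.
have rR1 : 1 <= r%:R :> R by rewrite ler1n.
have n0 : (0 < n)%N by rewrite expn_gt0 r0.
case=> [small|large].
  apply: le_trans (scale_sum_ge_resonant x n0 small).
  by rewrite lerN2 ler_wpM2l ?mulr_ge0// /n natrX ler_weXn2l.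
apply: le_trans (scale_sum_ge_generic x n0 (exprn_gt0 3 rR0) (exprn_gt0 2 rR0) large).
rewrite lerN2 [leRHS](_ : _ = m%:R * (3 * r%:R ^+ 7)); last by ring.
rewrite ler_wpM2l// /n natrX.
rewrite [leLHS](_ : _ = 3 / 2 * r%:R ^+ 7); last by field; rewrite gt_eqF.
by rewrite ler_wpM2r ?exprn_ge0//; lra.
Qed.

(** Being a factorial, the ratio of consecutive dilations is a multiple of
    each [h] that can witness the failure of genericity. *)
Definition scale_base r := ((4 * (r ^ 4)`!)`!)%N.
(** The extra factor by which the lengths decrease faster than the dilations
    increase is what the resonant bound asks for. *)
Definition scale_length r i :=
  ((scale_base r * ((r ^ 4)`! * r ^ 4 * r ^ 4)) ^ (r - i))%N.
Definition scale_dilation r i := (scale_base r ^ i)%N.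

Lemma scale_base_gt0 r : (0 < scale_base r)%N. Proof. exact: fact_gt0. Qed.

Lemma scale_length_gt0 r i : (0 < r)%N -> (0 < scale_length r i)%N.
Proof. by move=> r0; rewrite /scale_length !(expn_gt0, muln_gt0, fact_gt0, scale_base_gt0) r0. Qed.

(** The later dilation is a multiple of [h] times the one at [i0], so it takes
    [w] near a period too; the decay of the lengths makes this nearness
    sufficient for resonance. *)
Lemma resonant_after_nongeneric r (i0 i h : nat) (w : R) : (0 < r)%N ->
  (i0 < i < r)%N -> (0 < h <= 4 * (r ^ 4)`!)%N ->
  (scale_length r i0)%:R * `|sin (h%:R * ((scale_dilation r i0)%:R * w / 2))| <=
    (r ^ 4)%N%:R ->
  (scale_length r i)%:R * (r ^ 4)`!%:R * `|sin ((scale_dilation r i)%:R * w / 2)| *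
    (r ^ 4)%N%:R <= 1.
Proof.
move=> r0 /andP[i0i ir] hh; set s := `|sin _| => near.
have n0 : (0 < r ^ 4)%N by rewrite expn_gt0 r0.
have hQ : (h %| scale_base r)%N by exact: dvdn_fact.
pose d := (i - i0)%N; have d0 : (0 < d)%N by rewrite subn_gt0.
have iE : i = (i0 + d)%N by rewrite subnKC// ltnW.
have dilE : scale_dilation r i =
    (scale_base r ^ d.-1 * (scale_base r %/ h) * (h * scale_dilation r i0))%N.
  rewrite {1}iE /scale_dilation expnD -[in RHS]mulnA
    [(_ %/ _ * (h * _))%N]mulnA divnK//.
  by rewrite mulnA -expnSr prednK// mulnC.
have lenE : scale_length r i0 = (scale_length r i *
    (scale_base r * ((r ^ 4)`! * r ^ 4 * r ^ 4)) ^ d)%N.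
  by rewrite /scale_length -expnD; congr expn; lia.
have sin_le : `|sin ((scale_dilation r i)%:R * w / 2)| <= (scale_base r ^ d)%N%:R * s.
  rewrite dilE natrM -!mulrA [w / 2]mulrC (natrM _ h).
  apply: (le_trans (normr_sin_natmul _ _)).
  rewrite /s -!mulrA [2^-1 * w]mulrC ler_wpM2r// ler_nat.
  rewrite -[in leqRHS](prednK d0) expnSr leq_mul2l leq_div orbT//.
have pow_le : (scale_base r ^ d * ((r ^ 4)`! * r ^ 4 * r ^ 4) <=
    (scale_base r * ((r ^ 4)`! * r ^ 4 * r ^ 4)) ^ d)%N.
  rewrite expnMn leq_mul2l -[X in (X <= _)%N]expn1 leq_pexp2l ?orbT//.
  by rewrite muln_gt0 n0 muln_gt0 n0 fact_gt0.
have nR0 : 0 < (r ^ 4)%N%:R :> R by rewrite ltr0n.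
rewrite -(ler_pM2r nR0) mul1r (le_trans _ near)// lenE.
apply: (@le_trans _ _ ((scale_length r i)%:R * (r ^ 4)`!%:R *
    ((scale_base r ^ d)%N%:R * s) * (r ^ 4)%N%:R * (r ^ 4)%N%:R)).
  by rewrite !ler_wpM2r// ler_wpM2l// mulr_ge0.
rewrite [leLHS](_ : _ = (scale_length r i)%:R *
   (scale_base r ^ d * ((r ^ 4)`! * r ^ 4 * r ^ 4))%N%:R * s); last first.
  by rewrite !natrM; ring.
by rewrite ler_wpM2r ?normr_ge0// [in leRHS]natrM ler_wpM2l// ler_nat.
Qed.

(** Every scale before the first nongeneric one is generic and
    every scale after it is resonant, so at most one of the [r] scales
    is lost to the trivial bound. *)
Lemma multiscale_lower_bound r (x : nat -> nat -> R) (w : R) : (0 < r)%N ->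
  - (4 * r%:R ^+ 8) <= \sum_(i < r) (scale_length r i)%:R^-1 *
    scale_sum (r ^ 4) (scale_length r i) (x i) ((scale_dilation r i)%:R * w).
Proof.
move=> r0; pose n := (r ^ 4)%N.
pose generic (i : 'I_r) := `[< forall h, (0 < h <= 4 * n`!)%N -> n%:R <=
  (scale_length r i)%:R * `|sin (h%:R * ((scale_dilation r i)%:R * w / 2))| >].
pose F (i : 'I_r) := (scale_length r i)%:R^-1 *
    scale_sum n (scale_length r i) (x i) ((scale_dilation r i)%:R * w).
rewrite -[leRHS]/(\sum_(i < r) F i).
have lengthR0 i : 0 < (scale_length r i)%:R :> R by rewrite ltr0n scale_length_gt0.
have good (i : 'I_r) : (scale_length r i)%:R * n`!%:R *
      `|sin ((scale_dilation r i)%:R * w / 2)| * n%:R <= 1 \/ generic i ->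
    - (3 * r%:R ^+ 7) <= F i.
  move=> gi; rewrite /F [leRHS]mulrC ler_pdivlMr//.
  rewrite [leLHS](_ : _ = - (3 * (scale_length r i)%:R * r%:R ^+ 7)); last by ring.
  apply: scale_sum_ge_generic_or_resonant => //.
  by case: gi => [|/asboolP]; [left|right].
have one_bad : exists i0 : 'I_r, forall i, i != i0 -> - (3 * r%:R ^+ 7) <= F i.
  have [/existsP[i1 bad1]|/existsPn allgood] := boolP [exists i, ~~ generic i].
    case: (@arg_minnP _ i1 (fun i => ~~ generic i) (fun i : 'I_r => i : nat) bad1) => i0 bad0 min0.
    exists i0 => i; rewrite neq_ltn => /orP[ilt|igt]; apply: good.
      by right; apply: contraTT ilt => /min0; rewrite -leqNgt.
    left; move: bad0 => /asboolPn/existsNP[h]/not_implyP[hh]/negP; rewrite -ltNge => /ltW near.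
    by apply: resonant_after_nongeneric near => //; rewrite igt ltn_ord.
  exists (Ordinal r0) => i _; apply: good; right; exact: negbNE (allgood i).
have [i0 bad0] := one_bad; rewrite (bigD1 i0)//=.
have -> : - (4 * r%:R ^+ 8) = - r%:R ^+ 8 + - (3 * r%:R ^+ 8) :> R by ring.
apply: lerD.
  rewrite /F [leRHS]mulrC ler_pdivlMr// (le_trans _ (scale_sum_ge_trivial _ _ _ _))//.
  by rewrite mulNr lerN2 (natrX _ r 4) -exprM mulrC.
apply: (@le_trans _ _ (\sum_(i < r | i != i0) - (3 * r%:R ^+ 7))); last first.
  exact: ler_sum.
rewrite sumr_const; set c := #|_|.
have cr : (c <= r)%N by rewrite -[r in leqRHS]card_ord max_card.
rewrite [leLHS](_ : _ = - (3 * r%:R ^+ 7) *+ r); last first.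
  by rewrite -[RHS]mulr_natr; ring.
by apply: ler_wnMn2l.
Qed.

End Scales.

(** * Recurrence along a hyperbola *)

Section Hyperbola.
Variable R : realType.

Lemma sum_scale_sum0 n m (x : nat -> R) (psi : R) : (forall k, x k = 0) -> psi = 0 ->
  2 * scale_sum n m x psi = m%:R * (n%:R * (n%:R - 1)).
Proof.
move=> x0 ->; rewrite /scale_sum (eq_bigr (fun=> n%:R * (n%:R - 1) / 2)); last first.
  move=> k _; rewrite (eq_bigr (fun j : 'I_n => j%:R)); last first.
    move=> j _; rewrite (eq_bigr (fun=> 1)) ?sumr_const ?card_ord// => i _.
    by rewrite x0 !mulr0 addr0 cos0.
  elim: n => [|n IHn]; first by rewrite big_ord0 !mul0r.
  by rewrite big_ord_recr /= IHn -[n.+1%:R]natr1; field.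
by rewrite sumr_const card_ord -[_ *+ m]mulr_natl; field.
Qed.

(** A common value of all the products [a b] occurring in the scales. *)
Definition hyperbola_constant r :=
  ((r ^ 4)`! * scale_dilation r r * (scale_length r 0)`!)%N.

Lemma hyperbola_constant_gt0 r : (0 < hyperbola_constant r)%N.
Proof.
by rewrite /hyperbola_constant muln_gt0 fact_gt0 muln_gt0 fact_gt0 expn_gt0 scale_base_gt0.
Qed.

Lemma hyperbola_constant_div r i k : (0 < r)%N -> (i < r)%N -> (k < scale_length r i)%N ->
  exists q, hyperbola_constant r = ((r ^ 4)`! * scale_dilation r i * k.+1 * q)%N.
Proof.
move=> r0 ir km.
have /dvdnP[u uE] : (scale_dilation r i %| scale_dilation r r)%N.
  by rewrite dvdn_exp2l// ltnW.
have /dvdnP[u' uE'] : (k.+1 %| (scale_length r 0)`!)%N.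
  apply: dvdn_fact; rewrite /= (leq_trans km)// leq_pexp2l ?leq_sub//.
  by rewrite muln_gt0 scale_base_gt0 muln_gt0 expn_gt0 r0 muln_gt0 expn_gt0 r0 fact_gt0.
exists (u * u')%N; rewrite /hyperbola_constant uE uE'.
move: (_`!) (scale_dilation r i) (k.+1) => A B C; lia.
Qed.

(** Here [p] plays the role of a spectral measure on the torus, with [x0] at
    the origin.  The vanishing of its Fourier coefficients on the hyperbola [a b = N]
    makes the integral of the multiscale kernel vanish; the kernel is large at the
    origin and hardly negative elsewhere, so the mass at the origin is small. *)
Lemma hyperbola_recurrence r : (1 < r)%N ->
  forall (X : finType) (p v w : X -> R) (x0 : X),
  (forall x, 0 <= p x) -> v x0 = 0 -> w x0 = 0 ->
  (forall a b, (a * b)%N = hyperbola_constant r ->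
    \sum_x p x * cos (a%:R * v x + b%:R * w x) = 0) ->
  r%:R * p x0 <= 16 * \sum_x p x.
Proof.
move=> r1 X p v w x0 p0 v0 w0 null.
have r0 : (0 < r)%N by exact: ltnW.
have rR0 : 0 < r%:R :> R by rewrite ltr0n.
pose n := (r ^ 4)%N.
pose q i k := (hyperbola_constant r %/ (n`! * scale_dilation r i * k.+1))%N.
pose F x := \sum_(i < r) (scale_length r i)%:R^-1 *
    scale_sum n (scale_length r i) (fun k => (q i k)%:R * v x)
      ((scale_dilation r i)%:R * w x).
have F_null : \sum_x p x * F x = 0.
  rewrite /F; under eq_bigr do rewrite mulr_sumr.
  rewrite exchange_big big1 // => i _; under eq_bigr do rewrite mulrCA.
  rewrite -mulr_sumr /scale_sum; under eq_bigr do rewrite mulr_sumr.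
  rewrite exchange_big big1 ?mulr0// => k _; under eq_bigr do rewrite mulr_sumr.
  rewrite exchange_big big1// => j _; under eq_bigr do rewrite mulr_sumr.
  rewrite exchange_big big1// => l _.
  have lj : (0 < j - l)%N by rewrite subn_gt0.
  have [u uE] := hyperbola_constant_div r0 (ltn_ord i) (ltn_ord k).
  have qE : q i k = u.
    rewrite /q uE mulKn// !muln_gt0 fact_gt0 expn_gt0 scale_base_gt0//.
  under eq_bigr => x _.
    rewrite mulrA -natrM qE [X in _ + X]mulrA -natrM.
    over.
  apply: null; rewrite uE.
  have : ((n`! %/ (j - l)) * (j - l) = n`!)%N.
    by apply: divnK; apply: dvdn_fact; rewrite lj (leq_trans (leq_subr _ _))// ltnW.
  have reorder A B C D E : (A * B = C -> B * u * (E * A * D) = C * D * E * u)%N.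
    by move=> <-; lia.
  exact: reorder.
have F_ge x : - (4 * r%:R ^+ 8) <= F x.
  exact: (multiscale_lower_bound (fun i k => (q i k)%:R * v x) _ r0).
have F_x0 : r%:R ^+ 9 <= 4 * F x0.
  have Fi (i : 'I_r) : 2 * ((scale_length r i)%:R^-1 *
      scale_sum n (scale_length r i) (fun k => (q i k)%:R * v x0)
        ((scale_dilation r i)%:R * w x0)) = n%:R * (n%:R - 1).
    have v0k k : (q i k)%:R * v x0 = 0 by rewrite v0 mulr0.
    rewrite mulrCA (sum_scale_sum0 _ _ v0k) ?w0 ?mulr0//.
    by rewrite mulKf// pnatr_eq0 -lt0n scale_length_gt0.
  have -> : 4 * F x0 = 2 * (r%:R * (n%:R * (n%:R - 1))).
    rewrite [in LHS](_ : 4 = 2 * 2 :> R); last by ring.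
    rewrite -mulrA /F [2 * \sum_(_ < _) _]mulr_sumr (eq_bigr _ (fun i _ => Fi i)).
    by rewrite sumr_const card_ord -[_ *+ r]mulr_natl.
  have n2 : 2 <= n%:R :> R.
    by rewrite ler_nat (leq_trans r1)// -[leqLHS]expn1 leq_pexp2l.
  rewrite exprS [leRHS]mulrCA ler_pM2l//.
  have -> : r%:R ^+ 8 = n%:R * n%:R :> R by rewrite /n natrX -exprD.
  by nra.
have : 0 <= p x0 * (4 * F x0 - r%:R ^+ 9) by rewrite mulr_ge0 ?p0// subr_ge0.
have : - (4 * r%:R ^+ 8) * \sum_x p x <= \sum_(x | x != x0) p x * F x.
  rewrite mulr_sumr [leLHS](bigD1 x0)//= -[leRHS]add0r lerD//.
    by rewrite mulNr oppr_le0 mulr_ge0// mulr_ge0// exprn_ge0.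
  by apply: ler_sum => x _; rewrite mulrC ler_wpM2l.
move: F_null; rewrite (bigD1 x0)//=.
move: (\sum_(x | x != x0) _) (\sum_x p x) (p x0) (F x0) => S P p0' F0 e1 e2 e3.
rewrite -(ler_pM2l (exprn_gt0 8 rR0)) mulrA -exprSr; lra.
Qed.

End Hyperbola.

(** * Recurrence for finite sets of integers *)

Section FiniteRecurrence.
Variables (R : realType) (q : nat).

Definition angle (c : nat) : R := c%:R * (2 * pi / q%:R).

(** The squared modulus of a Fourier coefficient of the indicator
    function of the range of [e]. *)
Definition power_spectrum (I : finType) (e : I -> int) (c : nat) : R :=
  \sum_i \sum_j cos (angle c * (e i - e j)%:~R).

Lemma power_spectrum_ge0 (I : finType) (e : I -> int) c : 0 <= power_spectrum e c.
Proof.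
rewrite /power_spectrum (_ : \sum_i _ = (\sum_i 1 * cos (angle c * (e i)%:~R)) ^+ 2 +
    (\sum_i 1 * sin (angle c * (e i)%:~R)) ^+ 2) ?addr_ge0 ?sqr_ge0//.
rewrite sqr_trig_sum; apply: eq_bigr => i _; apply: eq_bigr => j _.
by rewrite !mul1r rmorphB mulrBr.
Qed.

Lemma power_spectrum0 (I : finType) (e : I -> int) : power_spectrum e 0 = #|I|%:R ^+ 2.
Proof.
rewrite /power_spectrum; under eq_bigr => i _ do under eq_bigr => j _ do
  rewrite /angle !mul0r cos0.
by rewrite !sumr_const -mulrnA -natrX expnS expn1.
Qed.

Lemma sum_angle (z : int) y : z != 0 -> (`|z| < q)%N ->
  \sum_(c < q) cos (angle c * z%:~R + y) = 0.
Proof.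
move=> z0 zq; rewrite -[RHS](sum_cos_period y z0 zq); apply: eq_bigr => c _.
by rewrite /angle; congr (cos (_ + _)); ring.
Qed.

Lemma sum_power_spectrum (I : finType) (e : I -> int) : injective e ->
  (forall i j, (`|(e i - e j)%R| < q)%N) ->
  \sum_(c < q) power_spectrum e c = q%:R * #|I|%:R.
Proof.
move=> einj bound; rewrite exchange_big /=.
have inner i : \sum_(c < q) \sum_j cos (angle c * (e i - e j)%:~R) = q%:R.
  rewrite exchange_big /= (bigD1 i)//= [X in _ + X]big1 ?addr0 => [|j ji].
    under eq_bigr do rewrite subrr mulr0 cos0.
    by rewrite sumr_const card_ord.
  under eq_bigr do rewrite -[_ * _]addr0.
  by rewrite sum_angle// subr_eq0 (inj_eq einj) eq_sym.
by rewrite (eq_bigr _ (fun i _ => inner i)) sumr_const mulr_natr.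
Qed.

(** The inverse Fourier transform of [power_spectrum e] at [X] counts the pairs
    with difference [X]; the phase [y] covers cosine and sine transforms at once. *)
Lemma sum_power_spectrum_cos (I : finType) (e : I -> int) (X : int) y :
  (forall i j, (`|X| + `|(e i - e j)%R| < q)%N) -> (forall i j, e i - e j != X) ->
  \sum_(c < q) power_spectrum e c * cos (angle c * X%:~R + y) = 0.
Proof.
move=> bound nX; under eq_bigr do rewrite mulr_suml.
rewrite exchange_big big1// => i _; under eq_bigr do rewrite mulr_suml.
rewrite exchange_big big1// => j _.
apply: (mulfI (_ : 2 != 0 :> R)); first by rewrite pnatr_eq0.
rewrite mulr0 mulr_sumr.
transitivity (\sum_(c < q) cos (angle c * (X - (e i - e j))%:~R + y) +
    \sum_(c < q) cos (angle c * (X - (e j - e i))%:~R + y)).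
  rewrite -big_split; apply: eq_bigr => c _ /=.
  rewrite (_ : angle c * (X - (e i - e j))%:~R + y =
    (angle c * X%:~R + y) - angle c * (e i - e j)%:~R); last first.
    by rewrite [in LHS]rmorphB; ring.
  rewrite (_ : angle c * (X - (e j - e i))%:~R + y =
    (angle c * X%:~R + y) + angle c * (e i - e j)%:~R); last first.
    by rewrite [in LHS]rmorphB -[e j - e i]opprB rmorphN; ring.
  by move: (angle c * X%:~R + y) => U; rewrite cosB cosD; ring.
rewrite !sum_angle ?addr0//.
- by rewrite subr_eq0 eq_sym.
- by have := bound j i; lia.
- by rewrite subr_eq0 eq_sym.
- by have := bound i j; lia.
Qed.

Lemma finite_recurrence r (I1 I2 : finType) (e1 : I1 -> int) (e2 : I2 -> int) (m : int) :
  (1 < r)%N -> injective e1 -> injective e2 ->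
  (forall i j, (hyperbola_constant r * (`|m| + 1) + `|(e1 i - e1 j)%R| < q)%N) ->
  (forall i j, (hyperbola_constant r * (`|m| + 1) + `|(e2 i - e2 j)%R| < q)%N) ->
  (16 * q ^ 2 < r * #|I1| * #|I2|)%N ->
  exists a b : nat, [/\ (a * b)%N = hyperbola_constant r,
    exists i j, e1 i - e1 j = b%:Z * m + a%:Z & exists i j, e2 i - e2 j = b%:Z * m - a%:Z].
Proof.
move=> r1 e1inj e2inj bound1 bound2 dense.
have [I10 I20] : (0 < #|I1|)%N /\ (0 < #|I2|)%N.
  by move: dense; case: #|I1| => [|?]; case: #|I2| => [|?] //; lia.
have [i10 _] := card_gt0P I10.
have q0 : (0 < q)%N by exact: leq_ltn_trans (bound1 i10 i10).
apply: contrapT => none.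
pose p (x : 'I_q * 'I_q) := power_spectrum e1 x.1 * power_spectrum e2 x.2.
pose v (x : 'I_q * 'I_q) := angle x.1 - angle x.2.
pose w (x : 'I_q * 'I_q) := m%:~R * (angle x.1 + angle x.2).
pose x0 : 'I_q * 'I_q := (Ordinal q0, Ordinal q0).
have angle0 : angle 0 = 0 by rewrite /angle mul0r.
have p0 x : 0 <= p x by rewrite mulr_ge0 ?power_spectrum_ge0.
have v0 : v x0 = 0 by rewrite /v subrr.
have w0 : w x0 = 0 by rewrite /w /= angle0 addr0 mulr0.
have pair_sum (G : nat -> nat -> R) : \sum_(x : 'I_q * 'I_q) G x.1 x.2 =
    \sum_(c < q) \sum_(d < q) G c d.
  by rewrite pair_bigA.
have null a b : (a * b)%N = hyperbola_constant r ->
    \sum_x p x * cos (a%:R * v x + b%:R * w x) = 0.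
  move=> ab.
  have aN : (a <= hyperbola_constant r)%N.
    by rewrite dvdn_leq ?hyperbola_constant_gt0// -ab dvdn_mulr.
  have bmN : (`|(b%:Z * m)%R| <= hyperbola_constant r * `|m|)%N.
    by rewrite abszM leq_mul// dvdn_leq ?hyperbola_constant_gt0// -ab dvdn_mull.
  have Xbound : (`|(b%:Z * m + a%:Z)%R| <= hyperbola_constant r * (`|m| + 1))%N.
    rewrite mulnDr muln1; move: (_ * `|m|)%N (b%:Z * m) aN bmN; lia.
  have Ybound : (`|(b%:Z * m - a%:Z)%R| <= hyperbola_constant r * (`|m| + 1))%N.
    rewrite mulnDr muln1; move: (_ * `|m|)%N (b%:Z * m) aN bmN; lia.
  rewrite (eq_bigr (fun x : 'I_q * 'I_q => power_spectrum e1 x.1 * power_spectrum e2 x.2 *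
    cos (angle x.1 * (b%:Z * m + a%:Z)%:~R + angle x.2 * (b%:Z * m - a%:Z)%:~R))); last first.
    move=> x _; congr (_ * cos _); rewrite /v /w rmorphD rmorphB rmorphM /=; ring.
  rewrite (pair_sum (fun c d => power_spectrum e1 c * power_spectrum e2 d * cos (angle c *
    (b%:Z * m + a%:Z)%:~R + angle d * (b%:Z * m - a%:Z)%:~R))).
  have [h1|h1] := pselect (exists i j, e1 i - e1 j = b%:Z * m + a%:Z).
    have h2 i j : e2 i - e2 j != b%:Z * m - a%:Z.
      by apply/eqP => h; apply: none; exists a, b; split=> //; exists i, j.
    rewrite big1// => c _; under eq_bigr do rewrite -mulrA addrC.
    rewrite -mulr_sumr sum_power_spectrum_cos ?mulr0// => i j.
    by rewrite (leq_ltn_trans _ (bound2 i j))// leq_add2r.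
  have {}h1 i j : e1 i - e1 j != b%:Z * m + a%:Z.
    by apply/eqP => h; apply: h1; exists i, j.
  rewrite exchange_big big1// => d _; under eq_bigr do rewrite mulrAC.
  rewrite -mulr_suml sum_power_spectrum_cos ?mul0r// => i j.
  by rewrite (leq_ltn_trans _ (bound1 i j))// leq_add2r.
have := hyperbola_recurrence r1 p0 v0 w0 null.
rewrite (pair_sum (fun c d => power_spectrum e1 c * power_spectrum e2 d)).
under eq_bigr do rewrite -mulr_sumr.
rewrite -mulr_suml !sum_power_spectrum//; last 2 first.
- by move=> i j; rewrite (leq_ltn_trans _ (bound2 i j))// leq_addl.
- by move=> i j; rewrite (leq_ltn_trans _ (bound1 i j))// leq_addl.
rewrite /p /= !power_spectrum0 -!natrX -!natrM ler_nat => le.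
move: dense; rewrite ltnNge => /negP[].
rewrite -(@leq_pmul2r (#|I1| * #|I2|)) ?muln_gt0 ?I10//.
by move: #|I1| #|I2| le => A B; rewrite -!mulnn; lia.
Qed.

End FiniteRecurrence.

(** * Sets of positive upper Banach density *)

(** On a divergent sequence [limn] returns [0], so a positive density is a
    genuine limit. *)
Lemma dense_windows (R : realType) (alpha : R) (E : set int) :
  0 < alpha -> upper_banach_density R E = alpha ->
  \forall N \near \oo, exists z,
    alpha / 2 * N.*2.+1%:R < (window_count E z N)%:R.
Proof.
move=> alpha0 dE.
have /cvgNpoint cE : upper_banach_density R E != point by rewrite dE gt_eqF.
have half : alpha / 2 < upper_banach_density R E by rewrite dE; lra.
near=> N; have : alpha / 2 < max_window_density R E N.
  by near: N; exact: (cvgr_gt _ cE _ half).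
case/sup_gt => [|_ [z _ <-]]; first by exists ((window_count E 0 N)%:R / N.*2.+1%:R), 0.
by rewrite ltr_pdivlMr ?ltr0n// => ?; exists z.
Unshelve. all: by end_near. Qed.

Lemma window_differences (E : set int) (z : int) (N : nat) :
  exists (I : finType) (e : I -> int), [/\ injective e, #|I| = window_count E z N,
    forall i, E (e i) & forall i j, (`|(e i - e j)%R| <= N.*2)%N].
Proof.
set A := fset_set (E `&` window z N).
have mem (i : A) : (E `&` window z N) (val i).
  have := valP i; rewrite in_fset_set ?inE//.
  exact/finite_setIr/finite_window.
exists A, val; split.
- exact: val_inj.
- by rewrite /window_count cardfE.
- by move=> i; have [] := mem i.
- move=> i j; have [_ +] := mem i; have [_ +] := mem j.
  by rewrite /window /=; move: (fsval i) (fsval j) => x y; lia.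
Qed.

Theorem corollary1p6 (R : realType) (alpha beta : R)
    (halpha : 0 < alpha) (hbeta : 0 < beta) :
  exists K : int, 1 <= K /\
    forall E1 E2 : set int,
      upper_banach_density R E1 = alpha ->
      upper_banach_density R E2 = beta ->
      multiples K `<=`
        diffset (sqset (diffset E1 E1)) (sqset (diffset E2 E2)).
Proof.
pose r := (Num.truncn (256 / (alpha * beta))).+2.
have r_large : 256 < r%:R * (alpha * beta).
  rewrite -ltr_pdivrMr ?mulr_gt0// (lt_le_trans (truncnS_gt _))// ler_nat.
  exact: leqnSn.
pose N0 := hyperbola_constant r; have N0_gt0 : (0 < N0)%N by exact: hyperbola_constant_gt0.
exists (4 * N0)%N%:Z; split; first by rewrite -[1]/(1%N%:Z) lez_nat muln_gt0.
move=> E1 E2 d1 d2 _ [m _ <-].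
pose H := (N0 * (`|m| + 1))%N.
have [N [[z1 dense1] [z2 dense2] HN]] : exists N : nat, [/\
    exists z, alpha / 2 * N.*2.+1%:R < (window_count E1 z N)%:R,
    exists z, beta / 2 * N.*2.+1%:R < (window_count E2 z N)%:R & (H <= N)%N].
  near \oo => N; exists N; split; near: N.
  - exact: dense_windows.
  - exact: dense_windows.
  - exact: nbhs_infty_ge.
have [I1 [e1 [e1inj cI1 E1e bound1]]] := window_differences E1 z1 N.
have [I2 [e2 [e2inj cI2 E2e bound2]]] := window_differences E2 z2 N.
rewrite -{}cI1 in dense1; rewrite -{}cI2 in dense2.
(* The margin [H] bounds [b m + a] and [b m - a] for all factorizations. *)
pose q := (N.*2.+1 + H)%N.
have qW : (q <= 2 * N.*2.+1)%N by rewrite /q; lia.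
have dense : (16 * q ^ 2 < r * #|I1| * #|I2|)%N.
  rewrite (@leq_ltn_trans (64 * N.*2.+1 ^ 2))//.
    by rewrite (leq_trans (n := 16 * (2 * N.*2.+1) ^ 2))// ?leq_mul2l ?leq_exp2r// -!mulnn; lia.
  rewrite -(ltr_nat R) (natrM _ 64) natrX (natrM _ (r * _)) (natrM _ r).
  have W0 : 0 < N.*2.+1%:R :> R by rewrite ltr0n.
  move: (N.*2.+1%:R) W0 (#|I1|%:R) (#|I2|%:R) dense1 dense2 => W W0 x y dx dy.
  have prod : alpha / 2 * W * (beta / 2 * W) <= x * y.
    by rewrite ler_pM ?mulr_ge0 ?divr_ge0// ltW.
  have rR0 : 0 < r%:R :> R by rewrite ltr0n.
  rewrite -mulrA; apply: lt_le_trans (_ : r%:R * (alpha / 2 * W * (beta / 2 * W)) <= _).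
    rewrite (_ : r%:R * _ = r%:R * (alpha * beta) / 4 * W ^+ 2); last by field.
    by rewrite ltr_pM2r ?exprn_gt0//; lra.
  by rewrite ler_pM2l.
have [a [b [ab [i [j Xij]] [i' [j' Yij]]]]] : exists a b : nat, [/\ (a * b)%N = N0,
    exists i j, e1 i - e1 j = b%:Z * m + a%:Z & exists i j, e2 i - e2 j = b%:Z * m - a%:Z].
  apply: (@finite_recurrence R q) => // i j.
  - by have := bound1 i j; rewrite -/N0 -/H /q; lia.
  - by have := bound2 i j; rewrite -/N0 -/H /q; lia.
exists ((b%:Z * m + a%:Z) ^+ 2).
  by exists (b%:Z * m + a%:Z) => //; rewrite -Xij; exists (e1 i) => //; exists (e1 j).
exists ((b%:Z * m - a%:Z) ^+ 2).
  by exists (b%:Z * m - a%:Z) => //; rewrite -Yij; exists (e2 i') => //; exists (e2 j').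
by rewrite -ab !PoszM; ring.
Unshelve. all: by end_near. Qed.
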